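(* Let $M$ be an $n$-dimensional smooth manifold and let $\bar g(t)$, $t\in I$ ($I$ an interval containing $0$), be a Ricci flow on modified Riemann extensions over $M$; that is, a smooth family of pseudo-Riemannian metrics on $T^*M$ satisfying $\frac{\partial \bar g}{\partial t}=-2\,\overline{\mathrm{Ric}}(\bar g(t))$ and such that, for each $t\in I$, $\bar g(t)$ is the modified Riemann extension determined by some torsion-free affine connection $\nabla(t)$ on $M$ and some symmetric $(0,2)$ tensor field $c(t)$ on $M$. Then the metric varies linearly with time: there is a time-independent symmetric $(0,2)$ tensor field $h$ on $T^*M$ such that $\bar g(t)=\bar g(0)+t\,h$ for all $t\in I$.
   Context: Let $M$ be an $n$-dimensional smooth manifold, $\nabla$ a torsion-free affine connection on $M$ with coefficients $\Gamma^l_{ij}$ in local coordinates $(x^1,\dots,x^n)$, and $c=(c_{ij})$ a symmetric $(0,2)$ tensor field on $M$. Let $(x^1,\dots,x^n,\omega_1,\dots,\omega_n)$ be the induced coordinates on the cotangent bundle $T^*M$ (the $\omega_i$ are the fibre, or ''extended'', coordinates); unstarred indices $i,j$ range over $1,\dots,n$ and refer to $x^i$, while starred indices $i^*=n+i$ range over $n+1,\dots,2n$ and refer to $\omega_i$. The modified Riemann extension determined by $(\nabla,c)$ is the pseudo-Riemannian metric $\bar g$ on $T^*M$ with local components $$\bar g_{ij}=-2\,\omega_l\Gamma^l_{ij}+c_{ij},\qquad \bar g_{ij^*}=\bar g_{j^*i}=\delta_i^j,\qquad \bar g_{i^*j^*}=0.$$ $\overline{\mathrm{Ric}}(\bar g)$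 denotes the Ricci tensor of the Levi-Civita connection of $\bar g$ on the $2n$-dimensional manifold $T^*M$. Ricci flow on modified Riemann extensions means, in this paper, an evolution of the metric under Ricci flow on $T^*M$ such that all the metrics obtained are modified Riemann extensions. *)

(* Defs.v *)
From HB Require Import structures.
From mathcomp Require Import all_boot all_order all_algebra.
From mathcomp Require Import all_classical all_reals all_analysis.
From mathcomp Require Import ring.
Set Implicit Arguments.
Unset Strict Implicit.
Unset Printing Implicit Defensive.
Import Order.TTheory GRing.Theory Num.Theory.
Import numFieldNormedType.Exports.
Local Open Scope classical_set_scope.
Local Open Scope ring_scope.

Section Smoothness.
Context {R : realType}.

Definition pderiv {m} (i : 'I_m) (f : 'rV[R]_m -> R) : 'rV[R]_m -> R :=
  fun x => 'D_(delta_mx 0 i) f x.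

Definition iter_pderiv {m} (s : seq 'I_m) (f : 'rV[R]_m -> R) : 'rV[R]_m -> R :=
  foldr pderiv f s.

(* C^infinity on a not necessarily open set: locally the restriction of a   *)
(* function all of whose iterated partial derivatives are differentiable on *)
(* an open neighbourhood. If A is open this is ordinary smoothness of f     *)
(* on A.                                                                    *)
Definition smooth_on {m} (A : set 'rV[R]_m) (f : 'rV[R]_m -> R) : Prop :=
  forall x, A x -> exists (U : set 'rV[R]_m) (F : 'rV[R]_m -> R),
    [/\ open_nbhs x U,
        forall s y, U y -> differentiable (iter_pderiv s F) y
      & forall y, A y -> U y -> F y = f y].

End Smoothness.

(* Charts are given by their domains and coordinate maps; coordinate maps   *)
(* are total functions, whose values outside the domain are irrelevant.     *)
Record charts (R : realType) (n : nat) (X : Type) := Charts {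
  chart_index : Type;
  chart_dom : chart_index -> set X;
  chart_coord : chart_index -> X -> 'rV[R]_n }.

Section Charts.
Context {R : realType} {n : nat} {X : Type}.
Variable A : charts R n X.
Implicit Types a b : chart_index A.

Definition chart_image a : set 'rV[R]_n := chart_coord a @` chart_dom a.

Definition overlap a b : set 'rV[R]_n :=
  chart_coord a @` (chart_dom a `&` chart_dom b).

(* The change of coordinates from a to b on overlap a b; 0 elsewhere.       *)
Definition transition a b (x : 'rV[R]_n) : 'rV[R]_n :=
  xget 0 [set y | exists p, [/\ chart_dom a p, chart_dom b p,
                                chart_coord a p = x & chart_coord b p = y]].

(* ('J f x) i j is the derivative of the j-th component of f with respect   *)
(* to the i-th variable.                                                    *)
Definition dtransition a b (x : 'rV[R]_n) : 'M[R]_n := 'J (transition a b) x.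

Record smooth_atlas : Prop := {
  atlas_cover : forall p, exists a, chart_dom a p;
  atlas_inj : forall a, set_inj (chart_dom a) (@chart_coord _ _ _ A a);
  atlas_open : forall a b, open (overlap a b);
  atlas_smooth : forall a b k,
    smooth_on (overlap a b) (fun x => transition a b x 0 k) }.

(* Tensor fields of type (0,2) and affine connections are families of       *)
(* components, one for each chart, as functions of the coordinates; only    *)
(* their values on the chart images are meaningful.                         *)
Definition tensor02 := chart_index A -> 'rV[R]_n -> 'M[R]_n.

(* T_ij = (dy^q/dx^i) (dy^r/dx^j) T'_qr                                      *)
Record is_tensor_field02 (T : tensor02) : Prop := {
  tensor_smooth : forall a i j, smooth_on (chart_image a) (fun x => T a x i j);
  tensor_transform : forall a b x, overlap a b x ->
    T a x = dtransition a b x *m T b (transition a b x)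
              *m (dtransition a b x)^T }.

Definition is_symmetric (T : tensor02) : Prop :=
  forall a x, chart_image a x -> (T a x)^T = T a x.

(* For nondegenerate continuous T the signature is locally constant.        *)
Definition is_pseudo_riemannian (T : tensor02) : Prop :=
  [/\ is_tensor_field02 T, is_symmetric T
    & forall a x, chart_image a x -> T a x \in unitmx].

(* G a x l i j is Gamma^l_ij, with nabla_{d_i} d_j = Gamma^l_ij d_l.         *)
Definition connection :=
  chart_index A -> 'rV[R]_n -> 'I_n -> 'I_n -> 'I_n -> R.

(* Gamma^l_ij (dy^p/dx^l)                                                   *)
(*   = Gamma'^p_qr (dy^q/dx^i) (dy^r/dx^j) + d^2 y^p / dx^i dx^j             *)
Record is_connection (G : connection) : Prop := {
  connection_smooth : forall a l i j,
    smooth_on (chart_image a) (fun x => G a x l i j);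
  connection_transform : forall a b x (p i j : 'I_n), overlap a b x ->
    let J := dtransition a b x in
    \sum_l G a x l i j * J l p =
      \sum_q \sum_r G b (transition a b x) p q r * J i q * J j r
      + pderiv i (pderiv j (fun y => transition a b y 0 p)) x }.

Definition torsion_free (G : connection) : Prop :=
  forall a x l i j, chart_image a x -> G a x l i j = G a x l j i.

Definition levi_civita (g : tensor02) : connection := fun a x l i j =>
  2^-1 * \sum_k invmx (g a x) l k *
    (pderiv i (fun y => g a y j k) x + pderiv j (fun y => g a y i k) x
     - pderiv k (fun y => g a y i j) x).

Definition metric_compatible (g : tensor02) (G : connection) : Prop :=
  forall a x i j k, chart_image a x ->
    pderiv k (fun y => g a y i j) x =
      \sum_l G a x l k i * g a x l j + \sum_l G a x l k j * g a x i l.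

Lemma pderiv_sym (g : tensor02) a x i j k : smooth_atlas -> is_symmetric g ->
  chart_image a x ->
  pderiv k (fun y => g a y i j) x = pderiv k (fun y => g a y j i) x.
Proof.
move=> sA gs ax; rewrite /pderiv; apply: near_eq_derive.
have oA : open (chart_image a).
  by rewrite /chart_image -[chart_dom a]setIid; exact: atlas_open.
near=> y; rewrite -{1}(gs a y) ?mxE//.
by near: y; exact: open_nbhs_nbhs.
Unshelve. all: by end_near. Qed.

Lemma levi_civita_lower (g : tensor02) a x i j p : is_pseudo_riemannian g ->
  chart_image a x ->
  \sum_l levi_civita g a x l i j * g a x p l =
  2^-1 * (pderiv i (fun y => g a y j p) x + pderiv j (fun y => g a y i p) x
          - pderiv p (fun y => g a y i j) x).
Proof.
move=> [_ _ gu] ax; rewrite /levi_civita.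
pose S k := pderiv i (fun y => g a y j k) x + pderiv j (fun y => g a y i k) x
          - pderiv k (fun y => g a y i j) x.
rewrite -[X in _ = 2^-1 * X]/(S p).
under eq_bigr do rewrite -mulrA mulr_suml.
rewrite -mulr_sumr; congr (_ * _); rewrite exchange_big/=.
rewrite (eq_bigr (fun k => (g a x *m invmx (g a x)) p k * S k)).
  rewrite mulmxV ?gu// (bigD1 p)//= big1 ?addr0 => [|k kp].
    by rewrite mxE eqxx mul1r.
  by rewrite mxE eq_sym (negPf kp) mul0r.
move=> k _; rewrite mxE mulr_suml; apply: eq_bigr => l _.
by rewrite mulrC mulrA.
Qed.

Lemma levi_civita_torsion_free g : smooth_atlas -> is_pseudo_riemannian g ->
  torsion_free (levi_civita g).
Proof.
move=> sA [_ gs _] a x l i j ax; congr (_ * _); apply: eq_bigr => k _.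
by rewrite [_ + pderiv j _ _]addrC (pderiv_sym i j k sA gs ax).
Qed.

Lemma levi_civita_compatible g : smooth_atlas -> is_pseudo_riemannian g ->
  metric_compatible g (levi_civita g).
Proof.
move=> sA gR a x i j k ax; have [_ gs _] := gR.
rewrite levi_civita_lower//.
under eq_bigr do rewrite -(gs a x ax) mxE.
rewrite levi_civita_lower// !(pderiv_sym j i _ sA gs ax).
by field.
Qed.

Lemma levi_civita_unique g (G : connection) a x l i j :
  smooth_atlas -> is_pseudo_riemannian g ->
  torsion_free G -> metric_compatible g G -> chart_image a x ->
  G a x l i j = levi_civita g a x l i j.
Proof.
move=> sA gR Gt Gc ax; have [_ gs gu] := gR.
pose L i j k := \sum_m G a x m i j * g a x k m.
have LC p q r : L p q r = L q p r by apply: eq_bigr => m _; rewrite Gt.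
have dE p q r : pderiv p (fun y => g a y q r) x = L p q r + L p r q.
  rewrite Gc// /L; congr (_ + _); apply: eq_bigr => m _.
  by rewrite -{1}(gs a x ax) mxE.
rewrite /levi_civita (eq_bigr (fun k => 2 * (invmx (g a x) l k * L i j k))).
  rewrite -mulr_sumr mulrA mulVf ?mul1r; last by rewrite pnatr_eq0.
  rewrite (eq_bigr (fun k => \sum_m
      invmx (g a x) l k * g a x k m * G a x m i j)).
    rewrite exchange_big/= (eq_bigr (fun m =>
      (invmx (g a x) *m g a x) l m * G a x m i j)); last first.
      by move=> m _; rewrite mxE mulr_suml.
    rewrite mulVmx ?gu// (bigD1 l)//= big1 ?addr0 => [|k kl].
      by rewrite mxE eqxx mul1r.
    by rewrite mxE eq_sym (negPf kl) mul0r.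
  move=> k _; rewrite /L mulr_sumr; apply: eq_bigr => m _.
  by rewrite -mulrA [g _ _ _ _ * _]mulrC.
by move=> k _; rewrite !dE (LC k i) (LC k j) (LC j i); ring.
Qed.

(* R(d_i, d_j) d_k = (curvature G a x l k i j) d_l, where                   *)
(* R(X,Y) = [nabla_X, nabla_Y] - nabla_[X,Y].                               *)
Definition curvature (G : connection) a x (l k i j : 'I_n) : R :=
  pderiv i (fun y => G a y l j k) x - pderiv j (fun y => G a y l i k) x
  + \sum_m (G a x l i m * G a x m j k - G a x l j m * G a x m i k).

(* Ric(Y, Z) is the trace of X |-> R(X, Y) Z.                               *)
Definition ricci (G : connection) : tensor02 := fun a x =>
  \matrix_(j, k) \sum_i curvature G a x i k i j.

End Charts.

Record smooth_manifold (R : realType) (n : nat) (M : topologicalType)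
    (A : charts R n M) : Prop := {
  manifold_hausdorff : hausdorff_space M;
  manifold_second_countable : @second_countable M;
  manifold_dom_open : forall a : chart_index A, open (chart_dom a);
  manifold_coord_continuous : forall a : chart_index A,
    {within chart_dom a, continuous (chart_coord a)};
  manifold_coord_open : forall (a : chart_index A) (O : set M),
    open O -> O `<=` chart_dom a -> open (chart_coord a @` O);
  manifold_atlas : smooth_atlas A }.

Section CotangentBundle.
Context {R : realType} {n : nat} {M : Type}.
Variable A : charts R n M.

(* A covector at a point is the family of its components in all the charts  *)
(* around that point, subject to w_i = (dy^j/dx^i) w'_j; the components in  *)
(* the other charts carry no information and are set to 0.                  *)
Record cotangent := Cotangent {
  ct_point : M;
  ct_comp : chart_index A -> 'rV[R]_n;
  ct_transform : forall a b, chart_dom a ct_point -> chart_dom b ct_point ->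
    ct_comp a = ct_comp b *m (dtransition a b (chart_coord a ct_point))^T;
  ct_comp_out : forall a, ~ chart_dom a ct_point -> ct_comp a = 0 }.

(* The induced coordinates (x^1, ..., x^n, w_1, ..., w_n): the indices i    *)
(* and i* are lshift n i and rshift n i.                                    *)
Definition cotangent_charts : charts R (n + n) cotangent := {|
  chart_index := chart_index A;
  chart_dom := fun a => [set z | chart_dom a (ct_point z)];
  chart_coord := fun a z => row_mx (chart_coord a (ct_point z)) (ct_comp z a) |}.

Definition is_modified_riemann_extension
    (D : connection A) (c : tensor02 A) (g : tensor02 cotangent_charts) : Prop :=
  forall (a : chart_index A) (z : 'rV[R]_(n + n)),
    chart_image (A := cotangent_charts) a z ->
    let x := lsubmx z in let w := rsubmx z in
    g a z = block_mx
      (\matrix_(i, j) (- 2 * (\sum_l w 0 l * D a x l i j) + c a x i j)) 1%:M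
      1%:M                                                              0.

End CotangentBundle.

Section RicciFlow.
Context {R : realType} {n : nat} {X : Type}.
Variable A : charts R n X.
Implicit Types (I : interval R) (g : R -> tensor02 A).

Definition smooth_family I g : Prop := forall (a : chart_index A) i j,
  smooth_on [set y : 'rV[R]_(1 + n) | lsubmx y 0 0 \in I
                                      /\ chart_image a (rsubmx y)]
            (fun y => g (lsubmx y 0 0) a (rsubmx y) i j).

(* The time derivative is taken within I: it is one-sided at an end point   *)
(* of I that belongs to I.                                                  *)
Definition ricci_flow I g : Prop :=
  [/\ forall t, t \in I -> is_pseudo_riemannian (g t),
      smooth_family I g
    & forall t a x i j, t \in I -> chart_image a x ->
        (s - t)^-1 * (g s a x i j - g t a x i j)
          @[s --> within [set` I] t^'] --> - 2 * ricci (levi_civita (g t)) a x i j].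

End RicciFlow.

Definition ricci_flow_on_modified_riemann_extensions (R : realType) (n : nat)
    (M : Type) (A : charts R n M) (I : interval R)
    (g : R -> tensor02 (cotangent_charts A)) : Prop :=
  ricci_flow I g /\
  forall t, t \in I -> exists (D : connection A) (c : tensor02 A),
    [/\ is_connection D, torsion_free D, is_tensor_field02 c, is_symmetric c
      & is_modified_riemann_extension D c (g t)].

(* Main.v *)
Require Import Defs.
From HB Require Import structures.
From mathcomp Require Import all_boot all_order all_algebra.
From mathcomp Require Import all_classical all_reals all_analysis.
From mathcomp Require Import ring.
Set Implicit Arguments.
Unset Strict Implicit.
Unset Printing Implicit Defensive.
Import Order.TTheory GRing.Theory Num.Theory.
Import numFieldNormedType.Exports.
Local Open Scope classical_set_scope.
Local Open Scope ring_scope.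

(** The reason for linearity is that the Ricci tensor of a modified Riemann
    extension sees only the connection, and a Ricci flow cannot change the
    connection.

    In the induced coordinates (x, w) the only Christoffel symbols of the
    extension of (D, c) that do not vanish are
      bar G^k_(i j) = D^k_(i j),
      bar G^(k* )_(i j* ) = bar G^(k* )_(j* i) = - D^j_(i k),
    and bar G^(k* )_(i j), which is affine in the fibre coordinates w with a
    linear part made of D and its first derivatives. The trace that defines the
    Ricci tensor uses bar G^(k* )_(i j) only through its derivatives along the
    fibre, which no longer contain c or w; the result is
      bar Ric_(j k) (x, w) = Ric(D)_(j k) (x) + Ric(D)_(k j) (x)
    (lemma [ricci_modified_riemann_extension]).

    Along the flow the component bar g_(i j) = - 2 w_l D^l_(i j) + c_(i j) hence
    has a time derivative that does not depend on w. So
    bar g_(i j) (x, e_l) - bar g_(i j) (x, 0) = - 2 D^l_(i j) (x) is constant in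
    time: the connection does not move ([flow_connection_cst]). Then neither does
    the Ricci tensor, and each component of the metric, having a constant time
    derivative, is affine in time ([constant_slope_affine], [flow_affine]).

    The tensor h is taken to be the difference quotient (g(r) - g(0)) / r for one
    time r <> 0 of the interval rather than - 2 Ric: as a linear combination of
    metrics it is a smooth symmetric tensor field for free.

    The argument compares w = e_l with w = 0 over the same point, so it needs
    every pair (x, w) to be the coordinates of a covector. Covectors are given by
    their components in all charts, and the components obtained from w in the
    other charts are compatible by the chain rule for transition maps
    ([dtransition_comp], [cotangent_chart_image]). *)

(** * Functions of one variable with constant slope *)

(** By the mean value theorem. The slopes are limits within [I], so at an end
    point of [I] only a one-sided slope is known; it still gives the continuity
    that the mean value theorem asks for there. *)
Lemma constant_slope_affine (R : realType) (I : interval R)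
    (f : R -> R) (l : R) :
  (forall t, t \in I ->
     (s - t)^-1 * (f s - f t) @[s --> within [set` I] t^'] --> l) ->
  forall s t, s \in I -> t \in I -> f t - f s = l * (t - s).
Proof.
move=> fl s t; wlog st : s t / s < t => [ih sI tI|sI tI].
  have [st|ts|->] := ltgtP s t; first exact: ih.
  - by rewrite -opprB ih// -mulrN opprB.
  - by rewrite !subrr mulr0.
have sub x : s <= x -> x <= t -> x \in I.
  by move=> sx xt; apply: (@interval_is_interval _ I s t) => //=; rewrite sx.
(* f is continuous along I because f y = f x + (y - x) * slope. *)
have fc x : x \in I -> f y @[y --> within [set` I] x^'] --> f x.
  move=> xI.
  have : f x + (y - x) * ((y - x)^-1 * (f y - f x))
      @[y --> within [set` I] x^'] --> f x + 0 * l.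
    apply: cvgD; first exact: cvg_cst.
    apply: cvgM; last exact: fl.
    apply: cvg_within_filter; apply: cvg_within_filter.
    suff : y - x @[y --> x] --> x - x by rewrite subrr.
    by apply: cvgB; [exact: cvg_id|exact: cvg_cst].
  rewrite mul0r addr0; apply: cvg_trans; apply: near_eq_cvg.
  apply: (@filter_app _ _ _ (fun y => y \in I)); last exact: withinT.
  apply: (@cvg_within _ x^'); apply: (@filterS _ _ _ _ _ _ (nbhs_dnbhs_neq x)).
  move=> y yx _; rewrite mulrA divff ?subr_eq0// mul1r.
  by rewrite addrC subrK.
(* At an interior point, limits within I are ordinary limits. *)
have dI x : s < x -> x < t -> x^' `=>` within [set` I] x^'.
  move=> sx xt P; rewrite /within/= => xP.
  have xst : \forall y \near x^', y \in `]s, t[.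
    by apply: nbhs_dnbhs; apply: near_in_itvoo; rewrite in_itv/= sx.
  apply: filterS2 xP xst => y yP; rewrite in_itv/= => /andP[sy yt].
  by apply/yP/sub; exact: ltW.
have [||c _ ->//] := @MVT R f (fun=> l) s t st.
- move=> x; rewrite in_itv/= => /andP[sx xt].
  have fxl : h^-1 *: (f (h *: 1 + x) - f x) @[h --> 0^'] --> l.
    have sh : (fun h : R => h + x) @ 0^' --> x^'.
      move=> P [e /= e0 eP]; exists e => //= h; rewrite /= sub0r normrN => he h0.
      apply: eP; first by rewrite /= opprD addrCA subrr addr0 normrN.
      by rewrite -subr_eq0 addrK.
    have := cvg_trans (cvg_app _ (dI x sx xt)) (fl x (sub x (ltW sx) (ltW xt))).
    move=> /(cvg_comp _ _ sh); apply: cvg_trans; apply: near_eq_cvg.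
    by near=> h; rewrite /= addrK /GRing.scale/= mulr1.
  apply: DeriveDef; last exact/cvg_lim.
  by apply/cvg_ex; exists l.
- apply/continuous_within_itvP => //; split.
  + move=> x; rewrite in_itv/= => /andP[sx xt].
    apply/continuous_withinNx.
    exact: cvg_trans (cvg_app _ (dI x sx xt)) (fc x (sub x (ltW sx) (ltW xt))).
  + apply: cvg_trans (fc s sI); apply: cvg_app => P.
    move=> fP.
    have {}fP : \forall y \near s, y != s -> y \in I -> P y := fP.
    change (\forall y \near s^'+, P y).
    have {}fP : \forall y \near s^'+, y != s -> y \in I -> P y.
      exact: cvg_within.
    near=> y; have sy : s < y by [].
    apply: (near fP y); [by []|by rewrite gt_eqF|apply: sub; first exact: ltW].
    by near: y; exact: nbhs_right_le.
  + apply: cvg_trans (fc t tI); apply: cvg_app => P.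
    move=> fP.
    have {}fP : \forall y \near t, y != t -> y \in I -> P y := fP.
    change (\forall y \near t^'-, P y).
    have {}fP : \forall y \near t^'-, y != t -> y \in I -> P y.
      exact: cvg_within.
    near=> y; have yt : y < t by [].
    apply: (near fP y); [by []|by rewrite lt_eqF|apply: sub; last exact: ltW].
    by near: y; exact: nbhs_left_ge.
Unshelve. all: by end_near. Qed.

(** * Differentiability and partial derivatives *)

(** [g] is [f] plus a function that vanishes near [x]; the latter has
    differential 0. *)
Lemma near_eq_differentiable (R : numFieldType) (V W : normedModType R)
    (f g : V -> W) (x : V) :
  {near x, f =1 g} -> differentiable f x -> differentiable g x.
Proof.
move=> fg df; rewrite -[g](subrK f); apply: differentiableD => //.
pose z : {linear V -> W} := \0%R.
have kE : (g - f) \o shift x = cst ((g - f) x) + z +o_0 id.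
  apply/eqaddoP => e e0; near=> y.
  have gfE u : f u = g u -> (g - f) u = 0.
    by move=> fgu; rewrite -[LHS]/(g u - f u) fgu subrr.
  suff -> : (((g - f) \o shift x) - (cst ((g - f) x) + z)) y = 0.
    by rewrite normr0 mulr_ge0// ltW.
  rewrite -[LHS]/((g - f) (y + x) - ((g - f) x + 0)) addr0.
  rewrite !gfE ?subrr//; first exact: nbhs_singleton fg.
  near: y; have := fg; rewrite (near_shift 0) subr0.
  by apply: filterS => y.
have c0 : continuous z by exact: cst_continuous.
by apply/diff_locallyP; rewrite (diff_unique c0 kE).
Unshelve. all: by end_near. Qed.

(** Jacobian matrices act on row vectors from the right, so the factors come
    in the order of composition. *)
Lemma jacobian_comp (R : realType) m n p (f : 'rV[R]_m -> 'rV[R]_n)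
    (h : 'rV[R]_n -> 'rV[R]_p) x :
  differentiable f x -> differentiable h (f x) ->
  'J (h \o f) x = 'J f x *m 'J h (f x).
Proof.
move=> df dh; apply/row_matrixP => i.
by rewrite rowE mul_rV_lin1 diff_comp//= rowE mulmxA !mul_rV_lin1.
Qed.

Lemma near_eq_jacobian (R : realType) m n (f h : 'rV[R]_m -> 'rV[R]_n) x :
  differentiable f x -> {near x, f =1 h} -> 'J f x = 'J h x.
Proof.
move=> df fh; have dh := near_eq_differentiable fh df.
have rowJ i (k : 'rV[R]_m -> 'rV[R]_n) : differentiable k x ->
    row i ('J k x) = 'D_('e_i) k x.
  by move=> dk; rewrite rowE -deriveEjacobian.
apply/row_matrixP => i; apply: etrans (rowJ _ _ df) _.
apply: etrans _ (esym (rowJ _ _ dh)); exact: near_eq_derive.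
Qed.

(** A directional derivative only depends on the restriction to a line, so it
    can be computed for another function in another space. *)
Lemma derive_along (R : realType) (V W : normedModType R) (f : V -> R)
    (F : W -> R) (v x : V) (w y : W) :
  (forall h : R, f (h *: v + x) = F (h *: w + y)) -> 'D_v f x = 'D_w F y.
Proof.
move=> fF; have fxFy : f x = F y by move: (fF 0); rewrite !scale0r !add0r.
rewrite /derive; set q := (fun _ : R => _); set Q := (fun _ : R => _).
by suff -> : q = Q by []; apply/funext => h; rewrite /q /Q /= fF fxFy.
Qed.

Lemma eq_pderiv_open (R : realType) m (U : set 'rV[R]_m)
    (f h : 'rV[R]_m -> R) i x :
  open U -> U x -> (forall y, U y -> f y = h y) -> pderiv i f x = pderiv i h x.
Proof.
move=> oU Ux fh; apply: near_eq_derive; near=> y.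
by apply: fh; near: y; exact: open_nbhs_nbhs.
Unshelve. all: by end_near. Qed.

Section SmoothOn.
Context {R : realType} {m : nat}.
Implicit Types (A : set 'rV[R]_m) (f : 'rV[R]_m -> R).

Lemma smooth_on_differentiable A f x : open A -> smooth_on A f -> A x ->
  differentiable f x.
Proof.
move=> oA sf Ax; have [U [F [Ux dF Ff]]] := sf x Ax.
apply: (@near_eq_differentiable _ _ _ F); last first.
  by apply: (dF [::]); exact: nbhs_singleton (open_nbhs_nbhs Ux).
near=> y; apply: Ff; first by near: y; exact: open_nbhs_nbhs.
by near: y; exact: open_nbhs_nbhs.
Unshelve. all: by end_near. Qed.

(** Each step differentiates an equality that must hold on a neighbourhood,
    which is why the induction runs over a whole open set. *)
Lemma iter_pderiv_lin (s : seq 'I_m) (U : set 'rV[R]_m)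
    (F G : 'rV[R]_m -> R) (k : R) :
  open U ->
  (forall s y, U y -> differentiable (iter_pderiv s F) y) ->
  (forall s y, U y -> differentiable (iter_pderiv s G) y) ->
  forall y, U y -> iter_pderiv s (fun x => k * F x + G x) y =
     k * iter_pderiv s F y + iter_pderiv s G y.
Proof.
move=> oU dF dG; elim: s => //= i s ih y Uy.
have dFy := diff_derivable (v := delta_mx 0 i) (dF s y Uy).
have dGy := diff_derivable (v := delta_mx 0 i) (dG s y Uy).
transitivity ('D_(delta_mx 0 i) (k \*: iter_pderiv s F + iter_pderiv s G) y).
  apply: near_eq_derive.
  by near=> z; apply: ih; near: z; exact: open_nbhs_nbhs.
by rewrite (deriveD (derivableZ (k := k) dFy) dGy) (deriveZ k dFy).
Unshelve. all: by end_near. Qed.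

Lemma smooth_on_lin A f g (k : R) : smooth_on A f -> smooth_on A g ->
  smooth_on A (fun x => k * f x + g x).
Proof.
move=> sf sg x Ax; have [U [F [Ux dF Ff]]] := sf x Ax.
have [V [G [Vx dG Gg]]] := sg x Ax.
have UVx := open_nbhsI Ux Vx; have [oUV _] := UVx.
exists (U `&` V), (fun x => k * F x + G x); split => //; last first.
  by move=> y Ay [Uy Vy]; rewrite Ff ?Gg.
have dF' s y : (U `&` V) y -> differentiable (iter_pderiv s F) y.
  by move=> [Uy _]; exact: dF.
have dG' s y : (U `&` V) y -> differentiable (iter_pderiv s G) y.
  by move=> [_ Vy]; exact: dG.
move=> s y UVy.
apply: (@near_eq_differentiable _ _ _
    (k \*: iter_pderiv s F + iter_pderiv s G)).
  near=> z; rewrite (iter_pderiv_lin s k oUV)//.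
  by near: z; exact: open_nbhs_nbhs.
by apply: differentiableD; [apply: differentiableZ; exact: dF'|exact: dG'].
Unshelve. all: by end_near. Qed.

Lemma smooth_on0 A : smooth_on A (fun=> 0).
Proof.
move=> x Ax; exists setT, (fun=> 0); split => [|s y _|//].
  by split => //; exact: openT.
suff -> : iter_pderiv s (fun=> 0) = (fun=> 0) :> ('rV[R]_m -> R).
  exact: differentiable_cst.
elim: s => //= i s ->; apply/funext => z; exact: derive_cst.
Qed.

End SmoothOn.

(** * Transition maps and coordinates of covectors *)

Section Transition.
Context {R : realType} {n : nat} {X : Type} {A : charts R n X}.
Hypothesis sA : smooth_atlas A.
Implicit Types a b : chart_index A.

Lemma transitionE a b p : chart_dom a p -> chart_dom b p ->
  transition a b (chart_coord a p) = chart_coord b p.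
Proof.
move=> ap bp; apply: xget_unique; first by exists p.
move=> y [q [aq bq qp <-]]; congr (chart_coord b _).
by apply: (atlas_inj sA (a := a)) => //; exact: mem_set.
Qed.

Lemma differentiable_transition a b x : overlap a b x ->
  differentiable (transition a b) x.
Proof.
move=> abx.
have -> : transition a b =
    \sum_(k < n) (fun y => transition a b y 0 k *: 'e_k).
  apply/funext => y; rewrite fct_sumE; exact: row_sum_delta.
apply: differentiable_sum => k; apply: differentiableZl.
apply: (@smooth_on_differentiable _ _ (overlap a b)) => //.
  exact: atlas_open.
exact: atlas_smooth.
Qed.

Lemma dtransition_id a p : chart_dom a p ->
  dtransition a a (chart_coord a p) = 1%:M.
Proof.
move=> ap; have aap : overlap a a (chart_coord a p) by exists p.
rewrite /dtransition (@near_eq_jacobian _ _ _ _ id).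
- by apply/row_matrixP => i; rewrite !rowE mul_rV_lin1 diff_val mulmx1.
- exact: differentiable_transition.
- near=> y.
  have [q [aq _] <-] : overlap a a y.
    by near: y; apply: open_nbhs_nbhs; split => //; exact: atlas_open.
  exact: transitionE.
Unshelve. all: by end_near. Qed.

End Transition.

Lemma open_chart_image (R : realType) (n : nat) (X : Type) (A : charts R n X)
    (a : chart_index A) : smooth_atlas A -> open (chart_image a).
Proof.
by move=> sA; rewrite /chart_image -[chart_dom a]setIid; exact: atlas_open.
Qed.

Section CotangentImage.
Context {R : realType} {n : nat} {M : topologicalType} {A : charts R n M}.
Hypothesis mA : smooth_manifold A.
Implicit Types a b c : chart_index A.

(** The cocycle identity: the chain rule applied to the composite of two
    transitions, which is the third one on the image of the triple overlap.
    That this image is open is where the topology of [M] enters. *)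
Lemma dtransition_comp a b c p :
  chart_dom a p -> chart_dom b p -> chart_dom c p ->
  dtransition a c (chart_coord a p) =
    dtransition a b (chart_coord a p) *m dtransition b c (chart_coord b p).
Proof.
have sA := manifold_atlas mA => ap bp cp.
have dab : differentiable (transition a b) (chart_coord a p).
  by apply: differentiable_transition => //; exists p.
have dbc :
    differentiable (transition b c) (transition a b (chart_coord a p)).
  by rewrite transitionE//; apply: differentiable_transition => //; exists p.
rewrite /dtransition -(transitionE sA ap bp).
apply: etrans (jacobian_comp dab dbc); apply: near_eq_jacobian.
  by apply: differentiable_transition => //; exists p.
have oabc :
    open (chart_coord a @` (chart_dom a `&` chart_dom b `&` chart_dom c)).
  apply: manifold_coord_open => // [|q [[]]//].
  by do 2?[apply: openI]; exact: manifold_dom_open.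
near=> y.
have [q [[aq bq] cq] <-] :
    (chart_coord a @` (chart_dom a `&` chart_dom b `&` chart_dom c)) y.
  by near: y; apply: open_nbhs_nbhs; split => //; exists p.
by rewrite /= !transitionE.
Unshelve. all: by end_near. Qed.

(** Every w is the component row of a covector: transporting w to the other
    charts by the Jacobians gives a compatible family by [dtransition_comp]. *)
Lemma cotangent_chart_image a :
  chart_image (A := cotangent_charts A) a = lsubmx @^-1` chart_image a.
Proof.
have sA := manifold_atlas mA.
apply/seteqP; split => [z [v av <-]|z [p ap px]] /=.
  by rewrite row_mxKl; exists (ct_point v).
pose w b : 'rV[R]_n := if `[< chart_dom b p >]
  then rsubmx z *m (dtransition b a (chart_coord b p))^T else 0.
have wE b : chart_dom b p ->
    w b = rsubmx z *m (dtransition b a (chart_coord b p))^T.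
  by move=> bp; rewrite /w asboolT.
have w_out b : ~ chart_dom b p -> w b = 0 by move=> bp; rewrite /w asboolF.
clearbody w.
have w_transform b c : chart_dom b p -> chart_dom c p ->
    w b = w c *m (dtransition b c (chart_coord b p))^T.
  move=> bp cp; rewrite (wE b bp) (wE c cp) -mulmxA -trmx_mul.
  by congr (_ *m _^T); exact: dtransition_comp.
exists (Cotangent w_transform w_out) => //=.
by rewrite wE// dtransition_id// trmx1 mulmx1 px hsubmxK.
Qed.

Lemma open_cotangent_chart_image a :
  open (chart_image (A := cotangent_charts A) a).
Proof.
rewrite cotangent_chart_image; apply: open_comp.
  by move=> z _; exact: continuous_lsubmx.
exact/open_chart_image/manifold_atlas.
Qed.

End CotangentImage.

(** * Functions affine along the fibres *)

Section FibreAffine.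
Context {R : realType} {n : nat}.
Implicit Types (x : 'rV[R]_n) (z : 'rV[R]_(n + n)).

(** Functions on the cotangent bundle that are affine along the fibres, in the
    coordinates (x, w): both the metric components and the Christoffel symbols
    of the extension have this form. *)
Definition fibre_affine (p : 'I_n -> 'rV[R]_n -> R) (q : 'rV[R]_n -> R) z : R :=
  \sum_l rsubmx z 0 l * p l (lsubmx z) + q (lsubmx z).

Lemma lsubmx_shift_base i h z :
  lsubmx (h *: 'e_(lshift n i) + z) = h *: 'e_i + lsubmx z.
Proof. by apply/rowP => j; rewrite !mxE eq_lshift. Qed.

Lemma rsubmx_shift_base i h z : rsubmx (h *: 'e_(lshift n i) + z) = rsubmx z.
Proof. by apply/rowP => j; rewrite !mxE eq_rlshift mulr0 add0r. Qed.

Lemma lsubmx_shift_fibre i h z : lsubmx (h *: 'e_(rshift n i) + z) = lsubmx z.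
Proof. by apply/rowP => j; rewrite !mxE eq_lrshift mulr0 add0r. Qed.

Lemma rsubmx_shift_fibre i h z :
  rsubmx (h *: 'e_(rshift n i) + z) = h *: 'e_i + rsubmx z.
Proof. by apply/rowP => j; rewrite !mxE eq_rshift. Qed.

Lemma pderiv_base i f z :
  pderiv (lshift n i) (fun y => f (lsubmx y)) z = pderiv i f (lsubmx z).
Proof. by apply: derive_along => h; rewrite lsubmx_shift_base. Qed.

Lemma pderiv_fibre_affine p q i z :
  pderiv (rshift n i) (fibre_affine p q) z = p i (lsubmx z).
Proof.
pose x := lsubmx z; pose r := fibre_affine p q z.
have -> : pderiv (rshift n i) (fibre_affine p q) z =
    'D_1 ((p i x \*o @id R) + cst r) 0.
  apply: derive_along => h; rewrite /fibre_affine lsubmx_shift_fibre -/x.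
  rewrite rsubmx_shift_fibre addr0 fctE/= /r /fibre_affine -/x addrA.
  congr (_ + _).
  rewrite (eq_bigr (fun l => h * (l == i)%:R * p l x + rsubmx z 0 l * p l x)).
    rewrite big_split/=; congr (_ + _).
    rewrite (bigD1 i)//= big1 => [|l li].
      by rewrite eqxx /GRing.scale/= !mulr1 addr0 mulrC.
    by rewrite (negPf li) mulr0 mul0r.
  by move=> l _; rewrite !mxE mulrDl.
have did : derivable (@id R) 0 1 by exact: derivable_id.
have dpid : derivable (p i x \*o @id R) 0 1.
  exact: (derivableZ (k := p i x) did).
rewrite (deriveD dpid (derivable_cst _ _ _)) (deriveMl _ did) derive_cst.
by rewrite derive_id mulr1 addr0.
Qed.

Lemma pderiv_base_affine p q i z :
  (forall l, differentiable (p l) (lsubmx z)) ->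
  differentiable q (lsubmx z) ->
  pderiv (lshift n i) (fibre_affine p q) z =
    \sum_l rsubmx z 0 l * pderiv i (p l) (lsubmx z) + pderiv i q (lsubmx z).
Proof.
move=> dp dq; pose w := rsubmx z; pose x := lsubmx z.
pose F := (\sum_l (w 0 l \*: p l)) + q.
have -> : pderiv (lshift n i) (fibre_affine p q) z = 'D_('e_i) F x.
  apply: derive_along => h; rewrite /F /fibre_affine.
  rewrite rsubmx_shift_base lsubmx_shift_base.
  rewrite -[RHS]/((\sum_l (w 0 l \*: p l)) (h *: 'e_i + x) + q (h *: 'e_i + x)).
  by rewrite fct_sumE.
have dpi l : derivable (p l) x 'e_i by exact: diff_derivable.
have dwp l : derivable (w 0 l \*: p l) x 'e_i by exact: derivableZ.
have ds : derivable (\sum_l (w 0 l \*: p l)) x 'e_i by exact: derivable_sum.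
rewrite (deriveD ds (diff_derivable dq)) (derive_sum dwp); congr (_ + _).
by apply: eq_bigr => l _; rewrite (deriveZ _ (dpi l)).
Qed.

End FibreAffine.

(** * The Ricci tensor of a modified Riemann extension *)

Section ModifiedRiemannExtension.
Context {R : realType} {n : nat} {M : topologicalType} {A : charts R n M}.
Variables (D : connection A) (c : tensor02 A).
Variable g : tensor02 (cotangent_charts A).
Hypothesis mA : smooth_manifold A.
Hypothesis connD : is_connection D.
Hypothesis tfD : torsion_free D.
Hypothesis tensc : is_tensor_field02 c.
Hypothesis gE : is_modified_riemann_extension D c g.
Variable a : chart_index A.

Local Notation W := (chart_image (A := cotangent_charts A) a).
Local Notation G := (levi_civita g a).
(* The indices i and i* of the coordinates x^i and w_i. *)
Local Notation "i '^x'" := (lshift n i) (at level 1, format "i '^x'").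
Local Notation "i '^w'" := (rshift n i) (at level 1, format "i '^w'").

Let oW : open W.
Proof. exact: open_cotangent_chart_image. Qed.

Let base z : W z -> chart_image a (lsubmx z).
Proof. by rewrite cotangent_chart_image. Qed.

Lemma extension_base z i j : W z -> g a z (i^x) (j^x) =
  fibre_affine (fun l x => - 2 * D a x l i j) (fun x => c a x i j) z.
Proof.
move=> Wz; rewrite (gE Wz)/= block_mxEul mxE mulr_sumr; congr (_ + _).
by apply: eq_bigr => l _; rewrite mulrCA.
Qed.

Lemma extension_base_fibre z i j : W z -> g a z (i^x) (j^w) = (i == j)%:R.
Proof. by move=> Wz; rewrite (gE Wz)/= block_mxEur mxE. Qed.

Lemma extension_fibre_base z i j : W z -> g a z (i^w) (j^x) = (i == j)%:R.
Proof. by move=> Wz; rewrite (gE Wz)/= block_mxEdl mxE. Qed.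

Lemma extension_fibre z i j : W z -> g a z (i^w) (j^w) = 0.
Proof. by move=> Wz; rewrite (gE Wz)/= block_mxEdr mxE. Qed.

Let dD x l i j : chart_image a x -> differentiable (fun y => D a y l i j) x.
Proof.
move=> ax; apply: smooth_on_differentiable ax; last exact: connection_smooth.
exact/open_chart_image/manifold_atlas.
Qed.

Let dc x i j : chart_image a x -> differentiable (fun y => c a y i j) x.
Proof.
move=> ax; apply: smooth_on_differentiable ax; last exact: tensor_smooth.
exact/open_chart_image/manifold_atlas.
Qed.

Lemma pderiv_locally_cst (f : 'rV[R]_(n + n) -> R) r k z :
  (forall y, W y -> f y = r) -> W z -> pderiv k f z = 0.
Proof.
move=> fr Wz; rewrite (eq_pderiv_open k oW Wz (h := cst r))//; exact: derive_cst.
Qed.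

Lemma pderiv_extension_base_fibre k i j z : W z ->
  pderiv k (fun y => g a y (i^x) (j^w)) z = 0.
Proof. apply: pderiv_locally_cst => y; exact: extension_base_fibre. Qed.

Lemma pderiv_extension_fibre_base k i j z : W z ->
  pderiv k (fun y => g a y (i^w) (j^x)) z = 0.
Proof. apply: pderiv_locally_cst => y; exact: extension_fibre_base. Qed.

Lemma pderiv_extension_fibre k i j z : W z ->
  pderiv k (fun y => g a y (i^w) (j^w)) z = 0.
Proof. apply: pderiv_locally_cst => y; exact: extension_fibre. Qed.

Lemma fibre_pderiv_extension k i j z : W z ->
  pderiv (k^w) (fun y => g a y (i^x) (j^x)) z = - 2 * D a (lsubmx z) k i j.
Proof.
move=> Wz.
rewrite (eq_pderiv_open _ oW Wz (fun y => @extension_base y i j)).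
exact: pderiv_fibre_affine.
Qed.

Lemma base_pderiv_extension k i j z : W z ->
  pderiv (k^x) (fun y => g a y (i^x) (j^x)) z =
  fibre_affine (fun l x => - 2 * pderiv k (fun y => D a y l i j) x)
               (fun x => pderiv k (fun y => c a y i j) x) z.
Proof.
move=> Wz; have az := base Wz.
rewrite (eq_pderiv_open _ oW Wz (fun y => @extension_base y i j)).
rewrite pderiv_base_affine; last exact: dc.
  congr (_ + _); apply: eq_bigr => l _; congr (_ * _).
  by apply: (deriveMl (-2)); apply: diff_derivable; exact: dD.
by move=> l; apply: differentiableZ; exact: dD.
Qed.

(** Twice the Christoffel symbol of the first kind, last index lowered. *)
Definition christoffel_first_kind2 z i j k :=
  pderiv i (fun y => g a y j k) z + pderiv j (fun y => g a y i k) z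
  - pderiv k (fun y => g a y i j) z.

Lemma invmx_extension z : W z ->
  invmx (g a z) = block_mx 0 1%:M 1%:M (- ulsubmx (g a z)).
Proof.
move=> Wz; set X := block_mx _ _ _ _.
have gX : g a z *m X = 1%:M.
  rewrite /X (gE Wz)/= block_mxKul mulmx_block.
  by rewrite !mulmx0 !mul0mx !mulmx1 !mul1mx !addr0 add0r subrr -scalar_mx_block.
have [gu _] := mulmx1_unit gX.
by rewrite -[LHS]mulmx1 -gX mulKmx.
Qed.

Lemma christoffel_upper_x z l i j : W z ->
  G z (l^x) i j = 2^-1 * christoffel_first_kind2 z i j (l^w).
Proof.
move=> Wz; rewrite /levi_civita; congr (_ * _).
rewrite big_split_ord/= big1 ?add0r => [|k _]; last first.
  by rewrite invmx_extension// block_mxEul mxE mul0r.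
rewrite (bigD1 l)//= big1 ?addr0 => [|k kl].
  by rewrite invmx_extension// block_mxEur mxE eqxx mul1r.
by rewrite invmx_extension// block_mxEur mxE eq_sym (negPf kl) mul0r.
Qed.

(** Since [g] has identity off-diagonal blocks, its inverse only mixes in the
    base block of [g], multiplied by symbols that [christoffel_upper_x] already
    computes. *)
Lemma christoffel_upper_w z l i j : W z ->
  G z (l^w) i j = 2^-1 * christoffel_first_kind2 z i j (l^x)
                  - \sum_k g a z (l^x) (k^x) * G z (k^x) i j.
Proof.
move=> Wz; rewrite {1}/levi_civita big_split_ord/= mulrDr; congr (_ + _).
  congr (_ * _); rewrite (bigD1 l)//= big1 ?addr0 => [|k kl].
    by rewrite invmx_extension// block_mxEdl mxE eqxx mul1r.
  by rewrite invmx_extension// block_mxEdl mxE eq_sym (negPf kl) mul0r.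
rewrite mulr_sumr -sumrN; apply: eq_bigr => k _.
rewrite christoffel_upper_x// invmx_extension// block_mxEdr.
by rewrite mxE mxE mxE mulNr mulrN mulrCA.
Qed.

Definition pderiv_extensionE :=
  (pderiv_extension_base_fibre, pderiv_extension_fibre_base,
   pderiv_extension_fibre, fibre_pderiv_extension).

(** In the names of the Christoffel symbols below, the letters tell the kind of
    each index, the upper one first. *)
Lemma christoffel_xxx z l i j : W z ->
  G z (l^x) (i^x) (j^x) = D a (lsubmx z) l i j.
Proof.
move=> Wz; rewrite christoffel_upper_x// /christoffel_first_kind2.
by rewrite !pderiv_extensionE//; field.
Qed.

Lemma christoffel_xxw z l i j : W z -> G z (l^x) (i^x) (j^w) = 0.
Proof.
move=> Wz; rewrite christoffel_upper_x// /christoffel_first_kind2.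
by rewrite !pderiv_extensionE//; field.
Qed.

Lemma christoffel_xwx z l i j : W z -> G z (l^x) (i^w) (j^x) = 0.
Proof.
move=> Wz; rewrite christoffel_upper_x// /christoffel_first_kind2.
by rewrite !pderiv_extensionE//; field.
Qed.

Lemma christoffel_xww z l i j : W z -> G z (l^x) (i^w) (j^w) = 0.
Proof.
move=> Wz; rewrite christoffel_upper_x// /christoffel_first_kind2.
by rewrite !pderiv_extensionE//; field.
Qed.

Lemma christoffel_wxw z l i j : W z ->
  G z (l^w) (i^x) (j^w) = - D a (lsubmx z) j i l.
Proof.
move=> Wz; rewrite christoffel_upper_w// /christoffel_first_kind2.
rewrite !pderiv_extensionE// big1 => [|k _]; last first.
  by rewrite christoffel_xxw// mulr0.
by field.
Qed.

Lemma christoffel_wwx z l i j : W z ->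
  G z (l^w) (i^w) (j^x) = - D a (lsubmx z) i j l.
Proof.
move=> Wz; rewrite christoffel_upper_w// /christoffel_first_kind2.
rewrite !pderiv_extensionE// big1 => [|k _]; last first.
  by rewrite christoffel_xwx// mulr0.
by field.
Qed.

Lemma christoffel_www z l i j : W z -> G z (l^w) (i^w) (j^w) = 0.
Proof.
move=> Wz; rewrite christoffel_upper_w// /christoffel_first_kind2.
rewrite !pderiv_extensionE// big1 => [|k _]; last first.
  by rewrite christoffel_xww// mulr0.
by field.
Qed.

(** The only symbol that involves [c] and w. The linear part is what survives
    in the curvature; [c] contributes to the constant part alone. *)
Lemma christoffel_wxx z l i j : W z ->
  G z (l^w) (i^x) (j^x) = fibre_affine
    (fun m x => 2 * (\sum_k D a x m l k * D a x k i j)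
       - (pderiv i (fun y => D a y m j l) x + pderiv j (fun y => D a y m i l) x
          - pderiv l (fun y => D a y m i j) x))
    (fun x => 2^-1 * (pderiv i (fun y => c a y j l) x
          + pderiv j (fun y => c a y i l) x - pderiv l (fun y => c a y i j) x)
       - \sum_k c a x l k * D a x k i j) z.
Proof.
move=> Wz; rewrite christoffel_upper_w// /christoffel_first_kind2.
rewrite !base_pderiv_extension//.
under eq_bigr => k _ do
  rewrite extension_base// christoffel_xxx// mulrDl mulr_suml.
rewrite /fibre_affine big_split/= exchange_big/=.
set x := lsubmx z; set w := rsubmx z.
set Sc := \sum_k c a x l k * _.
have sumD p : \sum_l w 0 l * (- 2 * p l) = - 2 * \sum_l w 0 l * p l.
  by rewrite mulr_sumr; apply: eq_bigr => m _; rewrite mulrCA.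
rewrite !sumD [X in _ - (X + _)](eq_bigr (fun m =>
    - 2 * (w 0 m * \sum_k D a x m l k * D a x k i j))); last first.
  by move=> m _; rewrite !mulr_sumr; apply: eq_bigr => k _; ring.
rewrite -mulr_sumr [in RHS](eq_bigr (fun m =>
    2 * (w 0 m * \sum_k D a x m l k * D a x k i j)
    - (w 0 m * pderiv i (fun y => D a y m j l) x
       + w 0 m * pderiv j (fun y => D a y m i l) x
       - w 0 m * pderiv l (fun y => D a y m i j) x))); last first.
  by move=> m _; ring.
by rewrite !(sumrB, big_split)/= -mulr_sumr; field.
Qed.

Lemma pderiv_connection_sym m l i j x : chart_image a x ->
  pderiv m (fun y => D a y l i j) x = pderiv m (fun y => D a y l j i) x.
Proof.
move=> ax.
have oa : open (chart_image a) by exact/open_chart_image/manifold_atlas.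
by rewrite (eq_pderiv_open m oa ax (fun y => @tfD a y l i j)).
Qed.

(** The terms with a starred summation index vanish, because a Christoffel
    symbol with upper index on the base is 0 as soon as one of its lower indices
    is on the fibre. *)
Lemma curvature_base z l k i j : W z ->
  curvature (levi_civita g) a z (l^x) (k^x) (i^x) (j^x)
    = curvature D a (lsubmx z) l k i j.
Proof.
move=> Wz; rewrite /curvature.
rewrite !(eq_pderiv_open _ oW Wz (fun y => @christoffel_xxx y _ _ _)).
rewrite (pderiv_base i (fun x => D a x l j k)).
rewrite (pderiv_base j (fun x => D a x l i k)).
rewrite big_split_ord/= [X in _ + (_ + X)]big1 => [|m _]; last first.
  by rewrite !christoffel_xxw// !mul0r subrr.
by rewrite addr0; congr (_ + _); apply: eq_bigr => m _; rewrite !christoffel_xxx.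
Qed.

(** Differentiating along the fibre extracts the linear part of
    [christoffel_wxx]; with the other products of symbols it recombines into a
    curvature component of [D] with its indices permuted. *)
Lemma curvature_fibre z l k i j : W z ->
  curvature (levi_civita g) a z (l^w) (k^x) (i^w) (j^x)
    = curvature D a (lsubmx z) i j l k.
Proof.
move=> Wz; have ax := base Wz; rewrite /curvature.
rewrite (eq_pderiv_open _ oW Wz (fun y => @christoffel_wxx y l j k)).
rewrite (eq_pderiv_open _ oW Wz (fun y => @christoffel_wwx y l i k)).
rewrite pderiv_fibre_affine (pderiv_base j (fun x => - D a x i k l)).
set x := lsubmx z in ax *.
have -> : pderiv j (fun x => - D a x i k l) x =
    - pderiv j (fun x => D a x i k l) x.
  by apply: deriveN; apply: diff_derivable; exact: dD.
rewrite big_split_ord/=.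
under [X in _ + (X + _)]eq_bigr => m _.
  rewrite christoffel_wwx// christoffel_xxx// christoffel_xwx// mulr0 subr0.
  rewrite (tfD i m l)// mulNr; over.
under [X in _ + (_ + X)]eq_bigr => m _.
  rewrite christoffel_www// christoffel_wxw// christoffel_wwx//.
  rewrite mul0r mulrNN sub0r.
  rewrite (tfD m j l)// mulrC; over.
rewrite !sumrN sumrB (pderiv_connection_sym _ _ j l)//.
rewrite (pderiv_connection_sym _ _ k j)//.
have -> : \sum_m D a x i l m * D a x m k j = \sum_m D a x i l m * D a x m j k.
  by apply: eq_bigr => m _; rewrite (tfD m k j).
ring.
Qed.

(** The two summands are the halves of the trace, over the indices i and over
    the indices i*. *)
Lemma ricci_modified_riemann_extension z j k : W z ->
  ricci (levi_civita g) a z (j^x) (k^x)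
    = ricci D a (lsubmx z) j k + ricci D a (lsubmx z) k j.
Proof.
move=> Wz; rewrite !mxE big_split_ord/=; congr (_ + _); apply: eq_bigr => i _.
  exact: curvature_base.
exact: curvature_fibre.
Qed.

End ModifiedRiemannExtension.

(** * Ricci flow on modified Riemann extensions *)

Lemma eq_ricci (R : realType) n (X : Type) (A : charts R n X)
    (D D' : connection A) (a : chart_index A) x :
  open (chart_image a) -> chart_image a x ->
  (forall y l i j, chart_image a y -> D a y l i j = D' a y l i j) ->
  ricci D a x = ricci D' a x.
Proof.
move=> oa ax DD'; apply/matrixP => j k; rewrite !mxE.
apply: eq_bigr => i _; rewrite /curvature.
rewrite (eq_pderiv_open _ oa ax (fun y => DD' y i j k)).
rewrite (eq_pderiv_open _ oa ax (fun y => DD' y i i k)).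
by congr (_ + _); apply: eq_bigr => m _; rewrite !DD'.
Qed.

Section Flow.
Context {R : realType} {n : nat} {M : topologicalType} {A : charts R n M}.
Variables (I : interval R) (g : R -> tensor02 (cotangent_charts A)).
Hypothesis mA : smooth_manifold A.
Hypothesis flow : ricci_flow_on_modified_riemann_extensions I g.

Lemma flow_slope (D : connection A) (c : tensor02 A) t (a : chart_index A) z j k :
  t \in I -> is_connection D -> torsion_free D -> is_tensor_field02 c ->
  is_modified_riemann_extension D c (g t) ->
  chart_image a (lsubmx z) ->
  (s - t)^-1 * (g s a z (lshift n j) (lshift n k)
                - g t a z (lshift n j) (lshift n k))
    @[s --> within [set` I] t^']
    --> - 2 * (ricci D a (lsubmx z) j k + ricci D a (lsubmx z) k j).
Proof.
move=> tI connD tfD tensc gtE ax; have [[_ _ gflow] _] := flow.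
have Wz : chart_image (A := cotangent_charts A) a z.
  by rewrite cotangent_chart_image.
rewrite -(ricci_modified_riemann_extension mA connD tfD tensc gtE)//.
exact: gflow.
Qed.

(** Over a fixed x, the slope given by [flow_slope] is the same for all w. Hence
    the components at w = e_l and at w = 0 keep their difference, which is
    - 2 D^l_(i j) (x). *)
Lemma flow_connection_cst (D D' : connection A) (c c' : tensor02 A) s t :
  s \in I -> t \in I ->
  is_modified_riemann_extension D c (g s) ->
  is_modified_riemann_extension D' c' (g t) ->
  forall (a : chart_index A) x l i j, chart_image a x ->
    D a x l i j = D' a x l i j.
Proof.
move=> sI tI gsE gtE a x l i j ax; have [_ gext] := flow.
pose u r w := g r a (row_mx x w) (lshift n i) (lshift n j).
have uE r (E : connection A) b w : is_modified_riemann_extension E b (g r) ->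
    u r w = - 2 * (\sum_m w 0 m * E a x m i j) + b a x i j.
  move=> grE; rewrite /u grE ?cotangent_chart_image//= ?row_mxKl//.
  by rewrite block_mxEul mxE row_mxKr.
have duE r (E : connection A) b : is_modified_riemann_extension E b (g r) ->
    u r 'e_l - u r 0 = - 2 * E a x l i j.
  move=> grE; rewrite (uE r E b 'e_l grE) (uE r E b 0 grE).
  rewrite [X in _ - (_ * X + _)]big1 => [|m _]; last by rewrite mxE mul0r.
  rewrite (bigD1 l)//= big1 => [|m ml]; last first.
    by rewrite mxE eqxx (negPf ml) mul0r.
  by rewrite mxE !eqxx/=; ring.
have slope0 r : r \in I -> (q - r)^-1 * ((u q 'e_l - u q 0) - (u r 'e_l - u r 0))
    @[q --> within [set` I] r^'] --> (0 : R).
  move=> rI; have [E [b [connE tfE tensb _ grE]]] := gext r rI.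
  have sl w := flow_slope (a := a) (z := row_mx x w) (j := i) (k := j)
    rI connE tfE tensb grE.
  have := cvgB (sl 'e_l _) (sl 0 _); rewrite !row_mxKl subrr => /(_ _ ax ax).
  apply: cvg_trans; apply: near_eq_cvg; near=> q.
  transitivity ((q - r)^-1 * (u q 'e_l - u r 'e_l)
      - (q - r)^-1 * (u q 0 - u r 0)); first by [].
  by rewrite -mulrBr; congr (_ * _); ring.
have := constant_slope_affine slope0 sI tI; rewrite mul0r => /eqP.
rewrite subr_eq0 (duE _ _ _ gsE) (duE _ _ _ gtE) => /eqP /mulfI -> //.
Unshelve. all: by end_near. Qed.

(** In the base block the slope is the Ricci tensor of a connection that does
    not change; the other blocks of an extension are constant. *)
Lemma flow_affine (a : chart_index A) z i j :
  chart_image (A := cotangent_charts A) a z ->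
  exists l : R, forall s t, s \in I -> t \in I ->
    g t a z i j - g s a z i j = l * (t - s).
Proof.
move=> Wz; have [_ gext] := flow.
have ax : chart_image a (lsubmx z) by move: Wz; rewrite cotangent_chart_image.
have [[r rI]|noI] := pselect (exists r, r \in I); last first.
  by exists 0 => s t sI; case: noI; exists s.
have [D [c [connD tfD tensc _ grE]]] := gext r rI.
have [i' ->|i' ->] := split_ordP i; have [j' ->|j' ->] := split_ordP j.
- pose l := - 2 * (ricci D a (lsubmx z) i' j' + ricci D a (lsubmx z) j' i').
  exists l; apply: constant_slope_affine => t tI.
  have [D' [c' [connD' tfD' tensc' _ gtE]]] := gext t tI.
  have oa : open (chart_image a) by exact/open_chart_image/manifold_atlas.
  rewrite /l (eq_ricci oa ax (flow_connection_cst rI tI grE gtE (a := a))).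
  exact: flow_slope gtE ax.
- exists 0 => s t sI tI; rewrite mul0r.
  have [D1 [c1 [_ _ _ _ ->//]]] := gext t tI.
  have [D2 [c2 [_ _ _ _ ->//]]] := gext s sI.
  by rewrite !block_mxEur subrr.
- exists 0 => s t sI tI; rewrite mul0r.
  have [D1 [c1 [_ _ _ _ ->//]]] := gext t tI.
  have [D2 [c2 [_ _ _ _ ->//]]] := gext s sI.
  by rewrite !block_mxEdl subrr.
- exists 0 => s t sI tI; rewrite mul0r.
  have [D1 [c1 [_ _ _ _ ->//]]] := gext t tI.
  have [D2 [c2 [_ _ _ _ ->//]]] := gext s sI.
  by rewrite !block_mxEdr subrr.
Qed.

End Flow.

(** * Linear combinations of tensor fields *)

Section TensorLinear.
Context {R : realType} {n : nat} {X : Type} {A : charts R n X}.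
Implicit Types (S T : tensor02 A) (k : R).

Lemma tensor_field02_lin k S T : is_tensor_field02 S -> is_tensor_field02 T ->
  is_tensor_field02 (fun a x => k *: S a x + T a x).
Proof.
move=> [sS tS] [sT tT]; split => [a i j|a b x abx].
  rewrite (_ : (fun x => _) = (fun x => k * S a x i j + T a x i j)).
    exact: smooth_on_lin.
  by apply/funext => x; rewrite !mxE.
by rewrite (tS a b)// (tT a b)// mulmxDr mulmxDl -scalemxAr -scalemxAl.
Qed.

Lemma tensor_field02_0 : is_tensor_field02 (fun (_ : chart_index A) _ => 0).
Proof.
split => [a i j|a b x _]; last by rewrite mulmx0 mul0mx.
rewrite (_ : (fun x => _) = (fun=> 0)); first exact: smooth_on0.
by apply/funext => x; rewrite mxE.
Qed.

End TensorLinear.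

(** * Linearity in time *)

Theorem theorem4 (R : realType) (n : nat) (M : topologicalType)
    (A : charts R n M) (I : interval R)
    (g : R -> tensor02 (cotangent_charts A)) :
  smooth_manifold A ->
  0 \in I ->
  ricci_flow_on_modified_riemann_extensions I g ->
  exists h : tensor02 (cotangent_charts A),
    [/\ is_tensor_field02 h, is_symmetric h
      & forall t, t \in I -> forall a z, chart_image a z ->
          g t a z = g 0 a z + t *: h a z].
Proof.
move=> mA I0 flow; have [[gR _ _] _] := flow.
(* If I is reduced to 0, r = 0 and any h will do. *)
have [r rI r0] : exists2 r, r \in I & r = 0 -> forall t, t \in I -> t = 0.
  have [[r [rI r0]]|noI] := pselect (exists r, r \in I /\ r != 0).
    by exists r => // rE; rewrite rE eqxx in r0.
  exists 0 => // _ t tI; apply/eqP; apply: contra_notT noI => t0.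
  by exists t.
exists (fun a z => r^-1 *: g r a z + ((- r^-1) *: g 0 a z + 0)); split.
- have [[gr _ _] [g0 _ _]] := (gR r rI, gR 0 I0).
  by apply: tensor_field02_lin => //; apply: tensor_field02_lin => //;
    exact: tensor_field02_0.
- move=> a z az; have [[_ grs _] [_ g0s _]] := (gR r rI, gR 0 I0).
  by rewrite addr0 linearD/= !linearZ/= grs// g0s.
- move=> t tI a z az; rewrite addr0 scaleNr -scalerBr.
  have [r_eq0|r_neq0] := eqVneq r 0.
    by rewrite (r0 r_eq0 t tI) scale0r addr0.
  apply/matrixP => i j; have [l gl] := flow_affine mA flow i j az.
  rewrite !mxE (gl 0 r I0 rI) -[LHS](subrK (g 0 a z i j)) (gl 0 t I0 tI).
  by rewrite !subr0 addrC; congr (_ + _); field.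
Qed.
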